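(* Consider the isentropic gas dynamics system set on an $N$-arc network, with no-flux conditions at the outer nodes and junction conditions with symmetric coefficients $\kappa_{i,j}=\kappa_{j,i}\ge 0$ at the junction nodes, discretized by the finite volume scheme described in the context, with, at each outer node $p$, the discrete boundary conditions $$\rho^n_{0,i}=\rho^n_{1,i},\ q^n_{0,i}=-q^n_{1,i}\ \text{ if } i\in\mathcal{O}_p,\qquad \rho^n_{J_i+1,i}=\rho^n_{J_i,i},\ q^n_{J_i+1,i}=-q^n_{J_i,i}\ \text{ if } i\in\mathcal{I}_p,$$ and, at each junction node $p$, the discrete junction conditions on the ghost states $U^*_i=(\rho^*_i,q^*_i)$ (at each time step $n$) $$-q^*_i=\sum_{j\in\mathcal{I}_p}\kappa_{i,j}(\rho^*_i-\rho^*_j)+\sum_{j\in\mathcal{O}_p}\kappa_{i,j}(\rho^*_i-\rho^*_j)\ \text{ if } i\in\mathcal{O}_p,$$ $$q^*_i=\sum_{j\in\mathcal{I}_p}\kappa_{i,j}(\rho^*_i-\rho^*_j)+\sum_{j\in\mathcal{O}_p}\kappa_{i,j}(\rho^*_i-\rho^*_j)\ \text{ if } i\in\mathcal{I}_p,$$ together with $$\mathcal{F}_i^{\rho}(U^*_i,U^n_{1,i})=q^*_i\ \text{ if } i\in\mathcal{O}_p,\qquad \mathcal{F}_i^{\rho}(U^n_{J_i,i},U^*_i)=q^*_i\ \text{ if } i\in\mathcal{I}_p.$$ Then the scheme is mass-preserving: the discrete mass $$m^n_{tot}=\Delta x\sum_{i=1}^N\sum_{j=1}^{J_i}\rho^n_{j,i}$$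 is independent of $n\in\mathbb{N}$.
   Context: Network: a finite connected graph with set of nodes $\mathcal{N}$ and $N$ arcs, each arc $i$ connecting a pair of nodes, identified with an interval $[0,L_i]$ and given an (artificial) orientation from $x=0$ to $x=L_i$. For a node $p$, $\mathcal{I}_p$ is the set of incoming arcs (those whose end $x=L_i$ is at $p$) and $\mathcal{O}_p$ the set of outgoing arcs (those whose end $x=0$ is at $p$). Outer nodes are those belonging to a single arc; all other nodes are junction nodes. At each junction node $p$, permeability coefficients $\kappa_{i,j}\ge0$ are given for $i,j\in\mathcal{I}_p\cup\mathcal{O}_p$ (they may depend on $p$). The system on each arc is $\partial_tU+\partial_xF(U)=0$, with $U=(\rho,q)$, $q=\rho u$, $\rho>0$, $F(U)=(q,\ q^2/\rho+p(\rho))$, $p(\rho)=p_0\rho^\gamma$, $p_0>0$, $\gamma>1$. Continuous junction condition at $p$ (which the scheme discretizes), where $\rho_j$ denotes the trace at $p$ of the density on arc $j$: $-q_i=\sum_{j\in\mathcal{I}_p\cup\mathcal{O}_p}\kappa_{i,j}(\rho_i-\rho_j)$ for $i\in\mathcal{O}_p$ and $q_i=\sum_{j\in\mathcal{I}_p\cup\mathcal{O}_p}\kappa_{i,j}(\rho_i-\rho_j)$ for $i\in\mathcal{I}_p$. The outer condition is $\partial_x\rho_i=0$, $q_i=0$ at outer nodes. Scheme: arc $i$ is divided into $J_i$ cells of equal length $\Delta x>0$ (the same for all arcs); $\Delta t>0$ is the time step; $U^n_{j,i}=(\rho^n_{j,i},q^n_{j,i})$, with $\rho^n_{j,i}>0$,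 is the approximate state in cell $j$ of arc $i$ at time $n\Delta t$. For $1\le j\le J_i$, $$U^{n+1}_{j,i}=U^n_{j,i}-\frac{\Delta t}{\Delta x}\left(\mathcal{F}_i(U^n_{j,i},U^n_{j+1,i})-\mathcal{F}_i(U^n_{j-1,i},U^n_{j,i})\right),$$ with the HLL numerical flux $$\mathcal{F}_i(U^-,U^+)=\frac{F(U^-)+F(U^+)}{2}-\frac{\lambda_i}{2}(U^+-U^-),$$ where $\mathcal{F}_i^{\rho}$ denotes its first component. The speed $\lambda_i>0$ satisfies $\lambda_i>|q/\rho|+\sqrt{p'(\rho)}$ for all cell states $U=(\rho,q)=U^n_{j,i}$ of arc $i$. Ghost cells: $U^n_{0,i}$ and $U^n_{J_i+1,i}$ are the ghost states of arc $i$. At a junction node $p$, the ghost state is $U^n_{J_i+1,i}=U^*_i$ for $i\in\mathcal{I}_p$ and $U^n_{0,i}=U^*_i$ for $i\in\mathcal{O}_p$ (separate starred states for each junction node and each time step); at outer nodes ghost states are given by the discrete boundary conditions. *)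

(* Defs.v *)
From mathcomp Require Import all_boot all_order all_algebra.
From mathcomp Require Import all_classical all_reals all_analysis.

Set Implicit Arguments.
Unset Strict Implicit.
Unset Printing Implicit Defensive.

Import Order.TTheory GRing.Theory Num.Theory.
Import numFieldNormedType.Exports.

Local Open Scope ring_scope.

Definition arc_adjacent (N : nat) (V : finType) (src tgt : 'I_N -> V) : rel V :=
  fun p q => [exists i, ((src i == p) && (tgt i == q))
                     || ((src i == q) && (tgt i == p))].

(* [arc_src i] is the end x = 0 of arc i and [arc_tgt i] its end x = L_i.
   Parallel arcs are allowed; loops are not, so that an arc incident to a node
   is either incoming or outgoing there, never both. *)
Record network (N : nat) := Network {
  node : finType;
  arc_src : 'I_N -> node;
  arc_tgt : 'I_N -> node;
  arc_src_neq_tgt : forall i, arc_src i != arc_tgt i;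
  network_connected : forall p q, connect (arc_adjacent arc_src arc_tgt) p q
}.

Section Nodes.
Variables (N : nat) (G : network N).

Definition incoming (p : node G) : {set 'I_N} := [set i | arc_tgt G i == p].
Definition outgoing (p : node G) : {set 'I_N} := [set i | arc_src G i == p].
Definition incident (p : node G) : {set 'I_N} := incoming p :|: outgoing p.
Definition outer_node (p : node G) : bool := #|incident p| == 1%N.
Definition junction_node (p : node G) : bool := ~~ outer_node p.

End Nodes.

(* A state is a pair (rho, q); [R^o] provides the vector space structure used
   in the finite volume update. *)
Definition state (R : realType) : Type := (R^o * R^o)%type.

Section Gas.
Variables (R : realType) (p0 gamma : R).

Definition density (U : state R) : R := U.1.
Definition discharge (U : state R) : R := U.2.

Definition pressure (r : R) : R := p0 * r `^ gamma.

Definition flux (U : state R) : state R :=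
  (discharge U, discharge U ^+ 2 / density U + pressure (density U)).

Definition hll_flux (lambda : R) (Um Up : state R) : state R :=
  2^-1 *: (flux Um + flux Up) - (lambda / 2) *: (Up - Um).

Definition hll_flux_rho (lambda : R) (Um Up : state R) : R :=
  density (hll_flux lambda Um Up).

Definition max_wave_speed (U : state R) : R :=
  `|discharge U / density U| + Num.sqrt ((pressure^`())%classic (density U)).

End Gas.

Section Scheme.
Variables (R : realType) (N : nat) (G : network N).
Variables (p0 gamma dx dt : R) (J : 'I_N -> nat) (lambda : 'I_N -> R).
Variable kappa : node G -> 'I_N -> 'I_N -> R.

(* [U n i j] is U^n_{j,i}: cells are 1 <= j <= J i, ghost cells are j = 0 and
   j = (J i).+1, and values at larger j play no role. *)
Variable U : nat -> 'I_N -> nat -> state R.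

(* [Ustar n p i] is the state U^*_i at the junction node p and time step n;
   only its values for i incident to p play a role. *)
Variable Ustar : nat -> node G -> 'I_N -> state R.

Definition finite_volume_update : Prop :=
  forall n i j, (1 <= j <= J i)%N ->
    U n.+1 i j = U n i j - (dt / dx) *:
      (hll_flux p0 gamma (lambda i) (U n i j) (U n i j.+1)
       - hll_flux p0 gamma (lambda i) (U n i j.-1) (U n i j)).

Definition outer_conditions : Prop :=
  forall n (p : node G), outer_node p ->
    (forall i, i \in outgoing p ->
       density (U n i 0%N) = density (U n i 1%N) /\
       discharge (U n i 0%N) = - discharge (U n i 1%N)) /\
    (forall i, i \in incoming p ->
       density (U n i (J i).+1) = density (U n i (J i)) /\
       discharge (U n i (J i).+1) = - discharge (U n i (J i))).

Definition junction_ghost_cells : Prop :=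
  forall n (p : node G), junction_node p ->
    (forall i, i \in outgoing p -> U n i 0%N = Ustar n p i) /\
    (forall i, i \in incoming p -> U n i (J i).+1 = Ustar n p i).

Definition junction_exchange (n : nat) (p : node G) (i : 'I_N) : R :=
  \sum_(j in incoming p)
     kappa p i j * (density (Ustar n p i) - density (Ustar n p j))
  + \sum_(j in outgoing p)
     kappa p i j * (density (Ustar n p i) - density (Ustar n p j)).

Definition junction_conditions : Prop :=
  forall n (p : node G), junction_node p ->
    (forall i, i \in outgoing p ->
       - discharge (Ustar n p i) = junction_exchange n p i) /\
    (forall i, i \in incoming p ->
       discharge (Ustar n p i) = junction_exchange n p i).

Definition junction_flux_conditions : Prop :=
  forall n (p : node G), junction_node p ->
    (forall i, i \in outgoing p ->
       hll_flux_rho p0 gamma (lambda i) (Ustar n p i) (U n i 1%N)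
       = discharge (Ustar n p i)) /\
    (forall i, i \in incoming p ->
       hll_flux_rho p0 gamma (lambda i) (U n i (J i)) (Ustar n p i)
       = discharge (Ustar n p i)).

Definition total_mass (n : nat) : R :=
  dx * \sum_(i < N) \sum_(1 <= j < (J i).+1) density (U n i j).

End Scheme.

(* Main.v *)
Require Import Defs.
From mathcomp Require Import all_boot all_order all_algebra.
From mathcomp Require Import all_classical all_reals all_analysis.

(** The finite volume update is conservative, so on each arc the interface
    fluxes telescope ([arc_mass_step]): in one time step the arc loses [dt]
    times the mass flux leaving at its end x = L_i minus the one entering at its
    end x = 0.  Each of these arc ends sits at exactly one node, so the total
    mass loss can be summed node by node instead of arc by arc
    ([sum_arc_ends_by_node]), and it suffices that no node absorbs or produces
    mass ([node_balance]).

    At an outer node, the reflected ghost state makes the mass flux vanish, the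
    average of the two opposite discharges and the density jump both being zero
    ([hll_flux_rho_reflect]).  At a junction node, the flux conditions identify
    the net mass flux from the arcs into the node with the sum over all incident
    arcs i of the exchange term sum_j kappa_ij (rho*_i - rho*_j).  The summand
    of this double sum is antisymmetric under i <-> j because kappa is
    symmetric, so the sum vanishes ([sum_antisymmetric]). *)

Import Order.TTheory GRing.Theory Num.Theory.

Local Open Scope ring_scope.

(** Exchanging the two summations shows that the sum is its own opposite. *)
Lemma sum_antisymmetric (R : numDomainType) (T : finType) (A : {set T})
    (f : T -> T -> R) :
  {in A &, forall i j, f i j = - f j i} ->
  \sum_(i in A) \sum_(j in A) f i j = 0.
Proof.
move=> fN; set S := (LHS); suff : S = - S.
  by move/eqP; rewrite eq_sym eqNr => /eqP.
rewrite {1}/S exchange_big /= -sumrN; apply: eq_bigr => i Ai.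
by rewrite -sumrN; apply: eq_bigr => j Aj; exact: fN.
Qed.

Lemma hll_flux_rhoE (R : realType) (p0 gamma lambda : R) (Um Up : state R) :
  hll_flux_rho p0 gamma lambda Um Up =
    2^-1 * (discharge Um + discharge Up)
    - lambda / 2 * (density Up - density Um).
Proof. by []. Qed.

Lemma hll_flux_rho_reflect (R : realType) (p0 gamma lambda : R)
    (Um Up : state R) :
  density Um = density Up -> discharge Um = - discharge Up ->
  hll_flux_rho p0 gamma lambda Um Up = 0.
Proof.
by move=> rE qE; rewrite hll_flux_rhoE rE qE addNr subrr !mulr0 subr0.
Qed.

Section Network.
Set Implicit Arguments.
Variables (N : nat) (G : network N).

(** An arc incident to a node is there exactly once, because the network has no
    loops. *)
Lemma sum_incident (V : nmodType) (p : node G) (f : 'I_N -> V) :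
  \sum_(i in incident p) f i =
    \sum_(i in incoming p) f i + \sum_(i in outgoing p) f i.
Proof.
rewrite (big_setID (incoming p)) /= finset.setUK finset.setDUl finset.setDv
  finset.set0U.
congr (_ + _); apply: eq_bigl => i.
rewrite !inE andb_idl // => /eqP <-.
by rewrite eq_sym; exact: arc_src_neq_tgt.
Qed.

(** The end x = L_i of an arc is at its target and the end x = 0 at its source,
    so grouping each of the two sums by the node concerned loses nothing. *)
Lemma sum_arc_ends_by_node (V : zmodType) (fin fout : 'I_N -> V) :
  \sum_i (fin i - fout i) =
    \sum_(p : node G)
      (\sum_(i in incoming p) fin i - \sum_(i in outgoing p) fout i).
Proof.
rewrite !sumrB (partition_big (arc_tgt G) xpredT) //=; congr (_ - _).
  by apply: eq_bigr => p _; apply: eq_bigl => i; rewrite inE.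
rewrite (partition_big (arc_src G) xpredT) //=.
by apply: eq_bigr => p _; apply: eq_bigl => i; rewrite inE.
Qed.

Section Scheme.
Variables (R : realType) (p0 gamma dx dt : R) (J : 'I_N -> nat).
Variables (lambda : 'I_N -> R) (kappa : node G -> 'I_N -> 'I_N -> R).
Variables (U : nat -> 'I_N -> nat -> state R).
Variables (Ustar : nat -> node G -> 'I_N -> state R).

(** Interface k lies between the cells k and k.+1, ghost cells included, so the
    ends x = 0 and x = L_i of the arc are the interfaces 0 and J i. *)
Let mass_flux n i k :=
  hll_flux_rho p0 gamma (lambda i) (U n i k) (U n i k.+1).

Lemma arc_mass_step n i : finite_volume_update p0 gamma dx dt J lambda U ->
  \sum_(1 <= j < (J i).+1) density (U n.+1 i j) =
    \sum_(1 <= j < (J i).+1) density (U n i j)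
    - dt / dx * (mass_flux n i (J i) - mass_flux n i 0).
Proof.
move=> scheme; rewrite -telescope_sumr // mulr_sumr !big_add1 /= -sumrB.
by apply: eq_big_nat => k kJ; rewrite scheme.
Qed.

Lemma outer_node_balance n (p : node G) :
  outer_conditions G J U -> outer_node p ->
  \sum_(i in incoming p) mass_flux n i (J i)
  - \sum_(i in outgoing p) mass_flux n i 0 = 0.
Proof.
move=> outer /(outer n) [out_p in_p].
rewrite !big1 ?subr0// => i.
- by move=> /out_p[rE qE]; exact: hll_flux_rho_reflect.
- by move=> /in_p[rE qE]; apply: hll_flux_rho_reflect; rewrite ?qE ?opprK.
Qed.

Lemma sum_junction_exchange n (p : node G) :
  {in incident p &, forall i j, kappa p i j = kappa p j i} ->
  \sum_(i in incident p) junction_exchange kappa Ustar n p i = 0.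
Proof.
move=> kappaC; under eq_bigr do rewrite /junction_exchange -sum_incident.
apply: sum_antisymmetric => i j pi pj.
by rewrite (kappaC i j) // -mulrN opprB.
Qed.

(** With the orientation of the arcs, the outward discharge is q* on outgoing
    arcs and - q* on incoming ones; the sign difference between the two junction
    conditions compensates for this, so that every incident arc contributes its
    exchange term with the same sign. *)
Lemma junction_node_balance n (p : node G) :
  {in incident p &, forall i j, kappa p i j = kappa p j i} ->
  junction_ghost_cells J U Ustar -> junction_conditions kappa Ustar ->
  junction_flux_conditions p0 gamma J lambda U Ustar -> junction_node p ->
  \sum_(i in incoming p) mass_flux n i (J i)
  - \sum_(i in outgoing p) mass_flux n i 0 = 0.
Proof.
move=> kappaC ghosts junction junction_flux p_junction.
have [ghost_out ghost_in] := ghosts n p p_junction.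
have [exch_out exch_in] := junction n p p_junction.
have [flux_out flux_in] := junction_flux n p p_junction.
rewrite -[RHS](sum_junction_exchange n kappaC) sum_incident -sumrN.
congr (_ + _); apply: eq_bigr => i pi; rewrite /mass_flux.
- by rewrite ghost_in // flux_in // exch_in.
- by rewrite ghost_out // flux_out // exch_out.
Qed.

Lemma node_balance n (p : node G) :
  (forall p, junction_node p ->
     {in incident p &, forall i j, kappa p i j = kappa p j i}) ->
  outer_conditions G J U ->
  junction_ghost_cells J U Ustar -> junction_conditions kappa Ustar ->
  junction_flux_conditions p0 gamma J lambda U Ustar ->
  \sum_(i in incoming p) mass_flux n i (J i)
  - \sum_(i in outgoing p) mass_flux n i 0 = 0.
Proof.
move=> kappaC outer ghosts junction junction_flux.
have [p_outer|p_junction] := boolP (outer_node p).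
  exact: outer_node_balance.
exact: (junction_node_balance n (kappaC p p_junction) ghosts).
Qed.

End Scheme.
End Network.

Theorem proposition6p1 (R : realType) (N : nat) (G : network N)
  (p0 gamma dx dt : R) (L : 'I_N -> R) (J : 'I_N -> nat) (lambda : 'I_N -> R)
  (kappa : node G -> 'I_N -> 'I_N -> R)
  (U : nat -> 'I_N -> nat -> state R)
  (Ustar : nat -> node G -> 'I_N -> state R)
  (p0_gt0 : 0 < p0) (gamma_gt1 : 1 < gamma)
  (dx_gt0 : 0 < dx) (dt_gt0 : 0 < dt)
  (L_gt0 : forall i, 0 < L i)
  (L_cells : forall i, L i = (J i)%:R * dx)
  (kappa_ge0 : forall p, junction_node p ->
     {in incident p &, forall i j, 0 <= kappa p i j})
  (kappa_sym : forall p, junction_node p ->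
     {in incident p &, forall i j, kappa p i j = kappa p j i})
  (density_gt0 : forall n i j, (1 <= j <= J i)%N -> 0 < density (U n i j))
  (lambda_gt0 : forall i, 0 < lambda i)
  (lambda_speed : forall n i j, (1 <= j <= J i)%N ->
     max_wave_speed p0 gamma (U n i j) < lambda i)
  (scheme : finite_volume_update p0 gamma dx dt J lambda U)
  (outer : outer_conditions G J U)
  (ghosts : junction_ghost_cells J U Ustar)
  (junction : junction_conditions kappa Ustar)
  (junction_flux : junction_flux_conditions p0 gamma J lambda U Ustar) :
  forall n m : nat, total_mass dx J U n = total_mass dx J U m.
Proof.
suff mass0 n : total_mass dx J U n = total_mass dx J U 0.
  by move=> n m; rewrite !mass0.
elim: n => // n <-; rewrite /total_mass; congr (_ * _).
under eq_bigr do rewrite (arc_mass_step _ _ scheme).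
rewrite sumrB -mulr_sumr (sum_arc_ends_by_node G) [X in dt / dx * X]big1.
  by rewrite mulr0 subr0.
move=> p _.
exact: node_balance kappa_sym outer ghosts junction junction_flux.
Qed.
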